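(* Let $1 < \kappa < \lambda$ be cardinals with $\lambda$ regular, and suppose that there is a stationary set $S \subseteq \lambda$ such that $\mathsf{sDSR}({<}\kappa, S)$ holds. Then $\square(\lambda, {<}\kappa)$ fails.
   Context: For an ordinal $\alpha$ and a set $S$ of ordinals, $S$ reflects at $\alpha$ if $\mathrm{cf}(\alpha) > \omega$ and $S \cap \alpha$ is stationary in $\alpha$. For $\lambda$ regular uncountable, $S \subseteq \lambda$ stationary and $\kappa \le \lambda$, $\mathsf{sDSR}({<}\kappa, S)$ is the assertion: whenever $\langle S_{\alpha,i} \mid \alpha<\lambda,\ i<j_\alpha\rangle$ is a matrix of stationary subsets of $S$ with $j_\alpha < \kappa$ for every $\alpha<\lambda$, there are an ordinal $\gamma<\lambda$ of uncountable cofinality and a stationary set $F \subseteq \gamma$ such that for every $\alpha \in F$ and every $i<j_\alpha$, $S_{\alpha,i}$ reflects at $\gamma$. A coherent sequence of length $\lambda$ is a sequence $\langle \mathcal{C}_\alpha \mid \alpha<\lambda \text{ limit}\rangle$ such that each $\mathcal{C}_\alpha$ is a nonempty collection of clubs in $\alpha$ and for every $C \in \mathcal{C}_\alpha$ and every limit point $\beta<\alpha$ of $C$, $C\cap\beta \in \mathcal{C}_\beta$; it has width ${<}\kappa$ if $|\mathcal{C}_\alpha|<\kappa$ for all limit $\alpha$. A thread is a club $T\subseteq\lambda$ such that $T\cap\beta\in\mathcal{C}_\beta$ for every limit point $\beta<\lambda$ of $T$. $\square(\lambda,{<}\kappa)$ asserts the existence of a coherent sequence of length $\lambda$ and width ${<}\kappa$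 with no thread. *)

(* Defs.v *)
Section OrdinalDefs.
Variable L : Type.
Variable lt : L -> L -> Prop.

Definition le (a b : L) : Prop := lt a b \/ a = b.

Definition injective {A B : Type} (f : A -> B) : Prop :=
  forall x y, f x = f y -> x = y.

Definition well_order : Prop :=
  (forall a, ~ lt a a) /\
  (forall a b c, lt a b -> lt b c -> lt a c) /\
  (forall a b, lt a b \/ a = b \/ lt b a) /\
  well_founded lt.

Definition seg (a : L) : Type := { x : L | lt x a }.

(* |X| < kappa, where kappa (an element of L that is a cardinal) is given as
   its initial segment: there is no injection from kappa into X (with AC this
   is exactly |X| < kappa). *)
Definition card_lt (X : Type) (k : L) : Prop :=
  ~ exists f : seg k -> X, injective f.

Definition is_cardinal (k : L) : Prop :=
  forall b, lt b k -> ~ exists f : seg k -> seg b, injective f.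

Definition regular_uncountable : Prop :=
  well_order /\
  (forall b : L, ~ exists f : L -> seg b, injective f) /\
  (forall X : L -> Prop, (forall b, exists x, X x /\ le b x) ->
     exists f : L -> { x : L | X x }, injective f) /\
  (~ exists f : L -> nat, injective f).

Definition is_limit (a : L) : Prop :=
  (exists b, lt b a) /\ (forall b, lt b a -> exists c, lt b c /\ lt c a).

Definition uncountable_cf (a : L) : Prop :=
  (exists b, lt b a) /\
  (forall f : nat -> L, (forall n, lt (f n) a) ->
     exists b, lt b a /\ forall n, lt (f n) b).

Definition unbounded_in (C : L -> Prop) (a : L) : Prop :=
  forall b, lt b a -> exists c, C c /\ le b c /\ lt c a.

Definition limit_point (C : L -> Prop) (b : L) : Prop :=
  is_limit b /\ unbounded_in (fun x => C x /\ lt x b) b.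

Definition club_in (C : L -> Prop) (a : L) : Prop :=
  (forall x, C x -> lt x a) /\ unbounded_in C a /\
  (forall b, lt b a -> limit_point C b -> C b).

Definition club (C : L -> Prop) : Prop :=
  (forall b, exists c, C c /\ le b c) /\
  (forall b, limit_point C b -> C b).

Definition stationary_in (S : L -> Prop) (a : L) : Prop :=
  forall D, club_in D a -> exists x, S x /\ lt x a /\ D x.

Definition stationary (S : L -> Prop) : Prop :=
  forall D, club D -> exists x, S x /\ D x.

Definition reflects (S : L -> Prop) (a : L) : Prop :=
  uncountable_cf a /\ stationary_in (fun x => S x /\ lt x a) a.

Definition sDSR (k : L) (S : L -> Prop) : Prop :=
  forall (j : L -> L) (M : L -> L -> (L -> Prop)),
    (forall a, lt (j a) k) ->
    (forall a i, lt i (j a) ->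
       (forall x, M a i x -> S x) /\ stationary (M a i)) ->
    exists g : L, exists F : L -> Prop,
      uncountable_cf g /\ (forall x, F x -> lt x g) /\ stationary_in F g /\
      (forall a, F a -> forall i, lt i (j a) -> reflects (M a i) g).

Definition coherent (Cs : L -> (L -> Prop) -> Prop) : Prop :=
  forall a, is_limit a ->
    (exists C, Cs a C) /\
    (forall C, Cs a C -> club_in C a) /\
    (forall C, Cs a C -> forall b, lt b a -> limit_point C b ->
       Cs b (fun x => C x /\ lt x b)).

Definition width_lt (Cs : L -> (L -> Prop) -> Prop) (k : L) : Prop :=
  forall a, is_limit a -> card_lt { C : L -> Prop | Cs a C } k.

Definition thread (Cs : L -> (L -> Prop) -> Prop) (T : L -> Prop) : Prop :=
  club T /\ forall b, limit_point T b -> Cs b (fun x => T x /\ lt x b).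

Definition square (k : L) : Prop :=
  exists Cs : L -> (L -> Prop) -> Prop,
    coherent Cs /\ width_lt Cs k /\ ~ exists T, thread Cs T.

End OrdinalDefs.

(* Main.v *)
(* Let [Cs] be a coherent sequence of width [<k].  For [D] in [Cs a], let
   [avoids a D] be the set of [b > a] in [S] such that no [C] in [Cs b] has [a]
   as a limit point with [C] cut at [a] equal to [D].  If these sets are
   stationary for all limit [a] in a club [E], then sDSR yields [g] and [F]; for
   [C] in [Cs g] and a limit point [a] of [C] in [F] and [E], put [D] to be [C]
   cut at [a]: reflection of [avoids a D] at [g] gives a limit point [b > a] of
   [C] in [avoids a D], contradicting coherence.  Otherwise, for stationarily
   many [a] some [D a] is such that [avoids a (D a)] is nonstationary.  Ordered by
   end-extension the sets [D a] form a tree; any [k] of them extend to members of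
   a single [Cs b], so there is no antichain of size [k], hence there is a
   cofinal chain, whose union is a thread. *)
Require Import Defs.
From Stdlib Require Import Classical ClassicalEpsilon ProofIrrelevance FunctionalExtensionality PropExtensionality.

(** * Extensionality, choice and well-founded recursion *)

Lemma pred_ext {T : Type} (P Q : T -> Prop) : (forall x, P x <-> Q x) -> P = Q.
Proof.
  intro H; apply functional_extensionality; intro x.
  apply propositional_extensionality; apply H.
Qed.

Lemma choice_fun {A B : Type} (P : A -> B -> Prop) :
  (forall a, exists b, P a b) -> exists f, forall a, P a (f a).
Proof.
  intro H. exists (fun a => proj1_sig (constructive_indefinite_description _ (H a))).
  intro a. exact (proj2_sig (constructive_indefinite_description _ (H a))).
Qed.

(** Recursion by [epsilon]. The guarantee at [a] is conditional, so a recursion may run out of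
    solutions, as in [enumerate_small]. *)
Lemma wf_choice {A T : Type} (r : A -> A -> Prop) (Hr : well_founded r) (t0 : T)
  (P : forall a, (forall b, r b a -> T) -> T -> Prop) :
  exists f : A -> T, forall a,
    (exists t, P a (fun b _ => f b) t) -> P a (fun b _ => f b) (f a).
Proof.
  set (F := fun a (g : forall b, r b a -> T) => epsilon (inhabits t0) (P a g)).
  exists (Fix Hr _ F). intros a Ha.
  rewrite Fix_eq.
  - unfold F at 1. apply epsilon_spec. exact Ha.
  - intros x f g Hfg. f_equal.
    apply functional_extensionality_dep; intro y.
    apply functional_extensionality; intro p. apply Hfg.
Qed.

(** * Limit points, clubs and small sets in a well-order *)

Section WellOrder.
Context {L : Type} {lt : L -> L -> Prop} (WO : well_order L lt).

Local Notation "a < b" := (lt a b).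
Local Notation "a <= b" := (le L lt a b).
Local Notation is_limit := (is_limit L lt).
Local Notation limit_point := (limit_point L lt).
Local Notation club_in := (club_in L lt).
Local Notation uncountable_cf := (uncountable_cf L lt).

Lemma lt_irr a : ~ a < a.
Proof. apply WO. Qed.

Lemma lt_tr {a b c} : a < b -> b < c -> a < c.
Proof. apply WO. Qed.

Lemma lt_total a b : a < b \/ a = b \/ b < a.
Proof. apply WO. Qed.

Lemma lt_wf : well_founded lt.
Proof. apply WO. Qed.

Lemma le_lt_tr {a b c} : a <= b -> b < c -> a < c.
Proof. intros [H|<-] H'; [exact (lt_tr H H')|exact H']. Qed.

Lemma lt_le_tr {a b c} : a < b -> b <= c -> a < c.
Proof. intros H [H'|<-]; [exact (lt_tr H H')|exact H]. Qed.

Lemma not_lt_le a b : ~ a < b -> b <= a.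
Proof. intro H. destruct (lt_total a b) as [?|[->|?]]; [easy|now right|now left]. Qed.

Lemma le_not_lt a b : a <= b -> ~ b < a.
Proof. intros H H'. exact (lt_irr _ (le_lt_tr H H')). Qed.

Lemma exists_max_lt {a b c} : a < c -> b < c -> exists m, m < c /\ a <= m /\ b <= m.
Proof.
  intros ac bc. destruct (lt_total a b) as [h|[->|h]].
  - exists b. repeat split; trivial; [now left|now right].
  - exists b. repeat split; trivial; now right.
  - exists a. repeat split; trivial; [now right|now left].
Qed.

Lemma least_elt (P : L -> Prop) :
  (exists x, P x) -> exists m, P m /\ forall y, y < m -> ~ P y.
Proof.
  intros [x Hx]. apply NNPP; intro N. revert Hx.
  induction x as [x IH] using (well_founded_ind lt_wf).
  intro Hx. apply N. exists x. split; [exact Hx|]. intros y Hy Py. exact (IH y Hy Py).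
Qed.

Lemma limit_next b x : is_limit b -> x < b -> exists y, x < y /\ y < b.
Proof. intros [_ H]; apply H. Qed.

Lemma limit_pointP (C : L -> Prop) b :
  limit_point C b <->
  is_limit b /\ forall x, x < b -> exists c, C c /\ x < c /\ c < b.
Proof.
  split; intros [Hb H]; split; trivial; intros x Hx.
  - destruct (limit_next b x Hb Hx) as (y & xy & yb).
    destruct (H y yb) as (c & (Cc & _) & yc & cb).
    exists c. repeat split; trivial. exact (lt_le_tr xy yc).
  - destruct (H x Hx) as (c & Cc & xc & cb).
    exists c. repeat split; trivial. now left.
Qed.

Lemma limit_point_mono (C D : L -> Prop) b :
  (forall x, x < b -> C x -> D x) -> limit_point C b -> limit_point D b.
Proof.
  rewrite !limit_pointP. intros H [Hb HC]. split; trivial. intros x Hx.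
  destruct (HC x Hx) as (c & Cc & xc & cb). exists c; auto.
Qed.

Lemma limit_point_trans (C : L -> Prop) b :
  limit_point (limit_point C) b -> limit_point C b.
Proof.
  rewrite !(limit_pointP _ b). intros [Hb H]. split; trivial. intros x Hx.
  destruct (H x Hx) as (c & Hc & xc & cb). apply limit_pointP in Hc.
  destruct (proj2 Hc x xc) as (d & Cd & xd & dc).
  exists d. repeat split; trivial. exact (lt_tr dc cb).
Qed.

(* [U] stands for an ordinal of uncountable cofinality or for the whole of [L]. *)
Definition countably_directed (U : L -> Prop) : Prop :=
  (forall x y, x < y -> U y -> U x) /\
  forall f : nat -> L, (forall n, U (f n)) -> exists b, U b /\ forall n, f n < b.

Lemma countably_directed_seg g :
  uncountable_cf g -> countably_directed (fun x => x < g).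
Proof. intros [_ H]. split; [intros x y; apply lt_tr|exact H]. Qed.

(** Iterating chosen [P]-successors from [b] gives an increasing omega-sequence; its supremum [c]
    stays in [U] by countable directedness, and the steps are cofinal in [c]. *)
Lemma closure_point (U : L -> Prop) (P : L -> L -> Prop) :
  countably_directed U ->
  (forall x, U x -> exists y, U y /\ x < y /\ P x y) ->
  forall b, U b -> exists c, U c /\ b < c /\ is_limit c /\
    forall y, y < c -> exists x z, y <= x /\ P x z /\ z < c.
Proof.
  intros [Udown Usup] step b Ub.
  destruct (choice_fun (fun x y => U x -> U y /\ x < y /\ P x y)) as [s Hs].
  { intro x. destruct (classic (U x)) as [Ux|N].
    - destruct (step x Ux) as [y Hy]. now exists y.
    - now exists x. }
  set (f := fix f n := match n with O => b | Datatypes.S m => s (f m) end).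
  assert (Uf : forall n, U (f n)).
  { induction n as [|n IH]; [exact Ub|]. apply (Hs (f n) IH). }
  destruct (least_elt (fun c => forall n, f n < c)) as (c & Hc & Hmin).
  { destruct (Usup f Uf) as (c & _ & Hc). now exists c. }
  assert (below : forall y, y < c -> exists x z, y <= x /\ x < z /\ P x z /\ z < c).
  { intros y yc. destruct (not_all_ex_not _ _ (Hmin y yc)) as [n Hn].
    destruct (Hs (f n) (Uf n)) as (_ & lts & HP).
    exists (f n), (s (f n)). repeat split; trivial.
    - now apply not_lt_le.
    - exact (Hc (Datatypes.S n)). }
  exists c. repeat split.
  - destruct (Usup f Uf) as (d & Ud & Hd).
    destruct (lt_total c d) as [h|[->|h]]; trivial.
    + exact (Udown c d h Ud).
    + destruct (Hmin d h Hd).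
  - exact (Hc O).
  - exists b. exact (Hc O).
  - intros y yc. destruct (below y yc) as (x & z & yx & xz & _ & zc).
    exists z. split; [exact (le_lt_tr yx xz)|exact zc].
  - intros y yc. destruct (below y yc) as (x & z & yx & _ & HP & zc).
    exists x, z; auto.
Qed.

Lemma uncountable_cf_limit g : uncountable_cf g -> is_limit g.
Proof.
  intros [H0 H]. split; trivial. intros b bg.
  destruct (H (fun _ => b) (fun _ => bg)) as (c & cg & bc).
  exists c. split; [exact (bc O)|exact cg].
Qed.

Lemma club_in_tail g b : uncountable_cf g -> b < g -> club_in (fun x => b < x /\ x < g) g.
Proof.
  intros Hg bg. pose proof (uncountable_cf_limit g Hg) as Lg.
  split; [now intros x [_ H]|split].
  - intros x xg. destruct (exists_max_lt bg xg) as (m & mg & bm & xm).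
    destruct (limit_next g m Lg mg) as (y & my & yg).
    exists y. repeat split; trivial.
    + exact (le_lt_tr bm my).
    + left; exact (le_lt_tr xm my).
  - intros x xg Hx. apply limit_pointP in Hx. destruct Hx as [[[z zx] _] Hx].
    destruct (Hx z zx) as (c & [bc _] & _ & cx). split; trivial. exact (lt_tr bc cx).
Qed.

(** Each step of [closure_point] passes a point of [C] and a point of [E], so the resulting ordinal
    is a limit point of both. *)
Lemma club_in_limit_points (C E : L -> Prop) g :
  uncountable_cf g -> club_in C g ->
  (forall x, limit_point E x -> E x) ->
  (forall b, b < g -> exists x, E x /\ b < x /\ x < g) ->
  club_in (fun x => limit_point C x /\ E x /\ x < g) g.
Proof.
  intros Hg (_ & Cu & _) Ecl Eu. pose proof (uncountable_cf_limit g Hg) as Lg.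
  split; [now intros x (_ & _ & H)|split].
  - intros b bg.
    destruct (closure_point (fun x => x < g)
      (fun x y => (exists c, C c /\ x < c /\ c <= y) /\ exists e, E e /\ x < e /\ e <= y)
      (countably_directed_seg g Hg)) with (b := b) as (c & cg & bc & Lc & Hc); trivial.
    + intros x xg. destruct (limit_next g x Lg xg) as (x' & xx' & x'g).
      destruct (Cu x' x'g) as (c & Cc & x'c & cg).
      destruct (Eu c cg) as (e & Ee & ce & eg).
      pose proof (lt_le_tr xx' x'c) as xc.
      exists e. split; [exact eg|]. split; [exact (lt_tr xc ce)|]. split.
      * exists c. repeat split; trivial. now left.
      * exists e. repeat split; trivial; [exact (lt_tr xc ce)|now right].
    + exists c. split; [split; [|split]|split]; trivial.
      * apply (limit_pointP C c). split; trivial. intros y yc.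
        destruct (Hc y yc) as (x & z & yx & [(d & Cd & xd & dz) _] & zc).
        exists d. repeat split; trivial; [exact (le_lt_tr yx xd)|exact (le_lt_tr dz zc)].
      * apply Ecl. apply limit_pointP. split; trivial. intros y yc.
        destruct (Hc y yc) as (x & z & yx & [_ (d & Ed & xd & dz)] & zc).
        exists d. repeat split; trivial; [exact (le_lt_tr yx xd)|exact (le_lt_tr dz zc)].
      * now left.
  - intros b bg Hb. split; [|split]; trivial.
    + apply limit_point_trans. revert Hb. apply limit_point_mono. tauto.
    + apply Ecl. revert Hb. apply limit_point_mono. tauto.
Qed.

(** Choose [e i] different from all earlier values while possible. If no [j] below [k] exhausts [X],
    then [e] is injective on [k], against [card_lt]. *)
Lemma enumerate_small (X : Type) (k : L) :
  inhabited X -> card_lt L lt X k ->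
  exists j, j < k /\ exists e : L -> X, forall x, exists i, i < j /\ e i = x.
Proof.
  intros [x0] HX.
  destruct (wf_choice lt lt_wf x0
    (fun i (rec : forall b, b < i -> X) x => forall b (h : b < i), rec b h <> x)) as [e He].
  apply NNPP; intro N. apply HX.
  assert (fresh : forall i, i < k -> forall b, b < i -> e b <> e i).
  { intros i ik. apply (He i). apply NNPP; intro Hno. apply N.
    exists i. split; trivial. exists e. intro x. apply NNPP; intro Hx. apply Hno.
    exists x. intros b bi <-. apply Hx. now exists b. }
  exists (fun i => e (proj1_sig i)). intros [i Hi] [i' Hi'] E. simpl in E.
  apply subset_eq_compat.
  destruct (lt_total i i') as [h|[h|h]]; trivial.
  - now destruct (fresh i' Hi' i h).
  - destruct (fresh i Hi i' h). now symmetry.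
Qed.

End WellOrder.

(** * Boundedness, clubs and stationary sets at a regular cardinal *)

Section Regular.
Context {L : Type} {lt : L -> L -> Prop} (Reg : regular_uncountable L lt).

Local Notation "a < b" := (lt a b).
Local Notation "a <= b" := (le L lt a b).
Local Notation is_limit := (is_limit L lt).
Local Notation limit_point := (limit_point L lt).
Local Notation club := (club L lt).
Local Notation stationary := (stationary L lt).

Let WO : well_order L lt := proj1 Reg.

Definition unbounded (X : L -> Prop) : Prop := forall b, exists x, X x /\ b <= x.

(** If the values of [g] had no strict bound, regularity would inject [L] into the range of [g], and
    choosing preimages would inject [L] into [I]. *)
Lemma small_family_bounded {I : Type} (g : I -> L) :
  ~ (exists f : L -> I, injective f) -> exists c, forall i, g i < c.
Proof.
  intro HI. apply NNPP; intro N. apply HI.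
  pose proof Reg as (_ & _ & cof & _).
  destruct (cof (fun x => exists i, g i = x)) as [f Hf].
  { intro b. apply NNPP; intro Nb. apply N. exists b. intro i. apply NNPP; intro Ni.
    apply Nb. exists (g i). split; [now exists i|]. now apply (not_lt_le WO). }
  destruct (choice_fun (fun a i => g i = proj1_sig (f a))) as [h Hh].
  { intro a. exact (proj2_sig (f a)). }
  exists h. intros x y E. apply Hf.
  assert (E' : proj1_sig (f x) = proj1_sig (f y)) by now rewrite <- !Hh, E.
  destruct (f x) as [u Hu], (f y) as [v Hv]; simpl in E'. subst v.
  f_equal. apply proof_irrelevance.
Qed.

Lemma seg_family_bounded b (g : L -> L) : exists c, forall a, a < b -> g a < c.
Proof.
  destruct (small_family_bounded (fun a : seg L lt b => g (proj1_sig a))) as [c Hc].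
  { apply Reg. }
  exists c. intros a ab. exact (Hc (exist _ a ab)).
Qed.

Lemma sequence_bounded (f : nat -> L) : exists c, forall n, f n < c.
Proof. apply small_family_bounded. apply Reg. Qed.

Lemma exists_gt b : exists c, b < c.
Proof. destruct (sequence_bounded (fun _ => b)) as [c Hc]. exists c. exact (Hc O). Qed.

Lemma exists_gt2 a b : exists c, a < c /\ b < c.
Proof.
  destruct (sequence_bounded (fun n => match n with O => a | _ => b end)) as [c Hc].
  exists c. split; [exact (Hc O)|exact (Hc 1)].
Qed.

Lemma countably_directed_all : countably_directed (lt := lt) (fun _ : L => True).
Proof.
  split; trivial. intros f _. destruct (sequence_bounded f) as [c Hc]. now exists c.
Qed.

Lemma unbounded_gt X b : unbounded X -> exists x, X x /\ b < x.
Proof.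
  intro H. destruct (exists_gt b) as [c bc]. destruct (H c) as (x & Xx & cx).
  exists x. split; trivial. exact (lt_le_tr WO bc cx).
Qed.

(** For unboundedness, regularity bounds one chosen point above [x] from each [B a] with [a <= x];
    at a closure point [c] of this process every [B a] with [a < c] is cofinal in [c], hence
    contains it. *)
Lemma club_diagonal (B : L -> L -> Prop) (b : L) :
  (forall a, club (B a)) ->
  club (fun x => b < x /\ is_limit x /\ forall a, a < x -> B a x).
Proof.
  intro HB. split.
  - intro d. destruct (exists_gt2 b d) as (m & bm & dm).
    destruct (closure_point WO (fun _ => True)
      (fun x y => forall a, a <= x -> exists z, B a z /\ x < z /\ z < y)
      countably_directed_all) with (b := m) as (c & _ & mc & Lc & Hc); trivial.
    + intros x _.
      destruct (choice_fun (fun a z => B a z /\ x < z)) as [g Hg].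
      { intro a. exact (unbounded_gt _ x (proj1 (HB a))). }
      destruct (exists_gt x) as [x' xx'].
      destruct (seg_family_bounded x' g) as [c Hc].
      exists c. split; [trivial|split].
      * exact (lt_tr WO (proj2 (Hg x)) (Hc x xx')).
      * intros a ax. exists (g a). split; [apply Hg|split; [apply Hg|]].
        apply Hc. exact (le_lt_tr WO ax xx').
    + exists c. split; [split; [exact (lt_tr WO bm mc)|split; [exact Lc|]]|
        left; exact (lt_tr WO dm mc)].
      intros a ac. apply HB. apply (limit_pointP WO). split; trivial. intros y yc.
      destruct (exists_max_lt WO ac yc) as (n & nc & an & yn).
      destruct (Hc n nc) as (x & z & nx & HP & zc).
      assert (ax : a <= x) by (destruct an as [h| ->]; [left; exact (lt_le_tr WO h nx)|exact nx]).
      destruct (HP a ax) as (w & Bw & xw & wz).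
      exists w. repeat split; trivial.
      * exact (le_lt_tr WO yn (le_lt_tr WO nx xw)).
      * exact (lt_tr WO wz zc).
  - intros x Hx. pose proof Hx as Hx0. apply (limit_pointP WO) in Hx. destruct Hx as [Lx Hx].
    split; [|split; trivial].
    + destruct (proj1 Lx) as [z zx]. destruct (Hx z zx) as (c & (bc & _) & _ & cx).
      exact (lt_tr WO bc cx).
    + intros a ax. apply HB. apply (limit_pointP WO). split; trivial. intros y yx.
      destruct (exists_max_lt WO ax yx) as (n & nx & an & yn).
      destruct (Hx n nx) as (c & (_ & _ & Hc) & nc & cx).
      exists c. repeat split; trivial.
      * apply Hc. exact (le_lt_tr WO an nc).
      * exact (le_lt_tr WO yn nc).
Qed.

Lemma stationary_diagonal (X : L -> Prop) (B : L -> L -> Prop) (b : L) :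
  stationary X -> (forall a, club (B a)) ->
  exists x, X x /\ b < x /\ is_limit x /\ forall a, a < x -> B a x.
Proof. intros HX HB. exact (HX _ (club_diagonal B b HB)). Qed.

Lemma club_ge b : club (fun x => b <= x).
Proof.
  split.
  - intro c. destruct (exists_gt2 b c) as (d & bd & cd). exists d. split; now left.
  - intros x Hx. apply (limit_pointP WO) in Hx. destruct Hx as [[[z zx] _] H].
    destruct (H z zx) as (c & bc & _ & cx). left. exact (le_lt_tr WO bc cx).
Qed.

Lemma stationary_inter_club X E : stationary X -> club E -> stationary (fun x => X x /\ E x).
Proof.
  intros HX HE D HD.
  assert (Hl : exists l : L, True).
  { destruct (HX D HD) as (x & _). now exists x. }
  destruct Hl as [l _]. destruct (exists_gt l) as [l' ll'].
  (* One diagonal intersection serves both clubs: index [l] carries [E], all others carry [D], and a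
     point beyond [l'] has both [l] and [l'] below it. *)
  destruct (stationary_diagonal X (fun a x => (a = l -> E x) /\ (a <> l -> D x)) l' HX)
    as (x & Xx & lx & _ & H).
  - intro a. destruct (classic (a = l)) as [e|n].
    + replace (fun x => (a = l -> E x) /\ (a <> l -> D x)) with E; trivial.
      apply pred_ext; tauto.
    + replace (fun x => (a = l -> E x) /\ (a <> l -> D x)) with D; trivial.
      apply pred_ext; tauto.
  - exists x. repeat split; trivial.
    + now apply (H l (lt_tr WO ll' lx)).
    + apply (H l' lx). intros ->. exact (lt_irr WO _ ll').
Qed.

(** * Ranks and cofinal chains in trees *)

(** [rk a] is the least strict upper bound of the ranks of the predecessors of [a] in [Z]. For [c]
    below it, some predecessor has rank at least [c]; if more, induction and transitivity give one
    of rank exactly [c]. *)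
Lemma exists_rank (Z : L -> Prop) (R : L -> L -> Prop) :
  (forall x y, R x y -> x < y) -> (forall x y z, R x y -> R y z -> R x z) ->
  exists rk : L -> L,
    (forall p a, Z p -> R p a -> rk p < rk a) /\
    (forall a c, c < rk a -> exists p, Z p /\ R p a /\ rk p = c).
Proof.
  intros Rlt Rtr.
  destruct (classic (exists l : L, True)) as [[l0 _]|Nl].
  2: { exists (fun x => x). split; intros; destruct Nl; eauto. }
  destruct (wf_choice lt (lt_wf WO) l0
    (fun a rec c => (forall p (h : p < a), Z p -> R p a -> rec p h < c) /\
       forall d, d < c -> ~ forall p (h : p < a), Z p -> R p a -> rec p h < d)) as [rk Hrk].
  assert (H : forall a, (forall p, p < a -> Z p -> R p a -> rk p < rk a) /\
    forall d, d < rk a -> ~ forall p, p < a -> Z p -> R p a -> rk p < d).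
  { intro a. apply (Hrk a). apply (least_elt WO).
    destruct (seg_family_bounded a rk) as [c Hc]. exists c. auto. }
  clear Hrk. exists rk. split.
  - intros p a Zp Rpa. apply H; auto.
  - induction a as [a IH] using (well_founded_ind (lt_wf WO)).
    intros c Hc. apply NNPP; intro N. apply (proj2 (H a) c Hc). intros p pa Zp Rpa.
    destruct (lt_total WO (rk p) c) as [h|[h|h]]; trivial.
    + destruct N. now exists p.
    + destruct (IH p pa c h) as (q & Zq & Rqp & Hq). destruct N.
      exists q. repeat split; trivial. exact (Rtr _ _ _ Rqp Rpa).
Qed.

(* If there is no cofinal chain, every node either has bounded extensions (only
   boundedly many such nodes, being essentially an antichain) or branches.  A
   branching node of rank at least [k] then has [k] predecessors, each with a
   witness branching off before the next predecessor; these witnesses form an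
   antichain. *)
Lemma stationary_tree_branch (k : L) (A : L -> Prop) (R : L -> L -> Prop) :
  stationary A ->
  (forall x y, R x y -> x < y) -> (forall x y z, R x y -> R y z -> R x z) ->
  (forall x y z, x < y -> R x z -> R y z -> R x y) ->
  (forall g : seg L lt k -> L, (forall i, A (g i)) -> injective g ->
     exists i i', R (g i) (g i')) ->
  exists B, unbounded B /\ (forall x, B x -> A x) /\
    forall x y, B x -> B y -> x < y -> R x y.
Proof.
  intros SA Rlt Rtr Rtree noanti. apply NNPP; intro nobranch.
  (* An unbounded [Z] has size lambda; restricting its enumeration to [seg k] would give an
     antichain that [noanti] excludes. *)
  assert (anti_bounded : forall Z : L -> Prop, (forall x, Z x -> A x) ->
    (forall x y, Z x -> Z y -> ~ R x y) -> exists c, forall x, Z x -> x < c).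
  { intros Z ZA Zanti. apply NNPP; intro N.
    pose proof Reg as (_ & _ & cof & _). destruct (cof Z) as [f Hf].
    - intro b. apply NNPP; intro Nb. apply N. exists b. intros x Zx.
      apply NNPP; intro h. apply Nb. exists x. split; trivial. now apply (not_lt_le WO).
    - destruct (noanti (fun i => proj1_sig (f (proj1_sig i)))) as (i & i' & HR).
      + intro i. apply ZA. apply proj2_sig.
      + intros [i Hi] [i' Hi'] E. apply subset_eq_compat. apply Hf.
        simpl in E. destruct (f i) as [u Hu], (f i') as [v Hv]. now apply subset_eq_compat.
      + refine (Zanti _ _ _ _ HR); apply proj2_sig. }
  set (splits := fun a c => exists x y, A x /\ A y /\ R a x /\ R a y /\
                  x < y /\ ~ R x y /\ y < c).
  (* [f a] bounds all extensions of [a] or an incomparable pair of them; were neither possible, the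
     extensions would form a cofinal chain. *)
  destruct (choice_fun (fun a c => (forall x, A x -> R a x -> x < c) \/ splits a c)) as [f Hf].
  { intro a. apply NNPP; intro N. apply nobranch.
    exists (fun x => A x /\ R a x). split; [|split].
    - intro b. apply NNPP; intro Nb. apply N. exists b. left. intros x Ax Rax.
      apply NNPP; intro h. apply Nb. exists x. split; [now split|]. now apply (not_lt_le WO).
    - tauto.
    - intros x y [Ax Rx] [Ay Ry] xy. apply NNPP; intro h. apply N.
      destruct (exists_gt y) as [c yc]. exists c. right. exists x, y. tauto. }
  (* Closure points of [f]: whatever lies below [f a] lies below every later point of [E]. *)
  set (E := fun x => forall a, a < x -> f a <= x).
  assert (AE : forall b, exists x, A x /\ E x /\ b < x).
  { intro b. destruct (stationary_diagonal A (fun a x => f a <= x) b SA) as (x & Ax & bx & _ & Ex).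
    - intro a. apply club_ge.
    - now exists x. }
  (* These points form an antichain: from [R x y] follows [y < f x], while [y] in [E] gives
     [f x <= y]. *)
  destruct (anti_bounded (fun x => A x /\ E x /\ ~ splits x (f x))) as [z Hz].
  { tauto. }
  { intros x y (Ax & Ex & Nx) (Ay & Ey & _) Rxy.
    destruct (Hf x) as [h|h]; [|tauto].
    exact (le_not_lt WO _ _ (Ey x (Rlt _ _ Rxy)) (h y Ay Rxy)). }
  set (Z := fun x => A x /\ E x /\ splits x (f x)).
  destruct (exists_rank Z R Rlt Rtr) as (rk & rk_lt & rk_onto).
  (* Each level of [Z] is an antichain because [rk] increases along [R], so it is bounded. *)
  destruct (choice_fun (fun i c => forall x, Z x -> rk x = i -> x < c)) as [bd Hbd].
  { intro i. destruct (anti_bounded (fun x => Z x /\ rk x = i)) as [c Hc].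
    - unfold Z; tauto.
    - intros x y [Zx Ex] [Zy Ey] Rxy. pose proof (rk_lt x y Zx Rxy) as h.
      rewrite Ex, Ey in h. exact (lt_irr WO _ h).
    - exists c. auto. }
  destruct (seg_family_bounded k bd) as [c Hc].
  (* Beyond [c] no point of [Z] has rank below [k]; beyond [z] all points of [A] in [E] split. So
     [a] will be in [Z] with rank at least [k]. *)
  destruct (exists_gt2 c z) as (m & cm & zm).
  destruct (AE m) as (a & Aa & Ea & ma).
  assert (Za : Z a).
  { split; [|split]; trivial. apply NNPP; intro h.
    apply (lt_irr WO a). apply (lt_tr WO (b := z)).
    - apply Hz. tauto.
    - exact (lt_tr WO zm ma). }
  assert (ka : k <= rk a).
  { apply (not_lt_le WO). intro h. apply (lt_irr WO a).
    apply (lt_tr WO (Hbd _ a Za eq_refl)). apply (lt_tr WO (Hc _ h)).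
    exact (lt_tr WO cm ma). }
  (* The pair is a predecessor [p] of [a] of rank [i] and an extension [d] of [p] below [f p] that
     is not [R]-below [a]. By [Rtree], two incomparable extensions of [p] cannot both be [R]-below
     [a]. *)
  destruct (choice_fun (fun (i : seg L lt k) pd =>
      Z (fst pd) /\ R (fst pd) a /\ rk (fst pd) = proj1_sig i /\
      A (snd pd) /\ R (fst pd) (snd pd) /\ snd pd < f (fst pd) /\ ~ R (snd pd) a)) as [g Hg].
  { intros [i ik]. destruct (rk_onto a i (lt_le_tr WO ik ka)) as (p & Zp & Rpa & Hp).
    destruct Zp as (Ap & Ep & Sp). pose proof Sp as (x & y & Ax & Ay & Rpx & Rpy & xy & Nxy & yf).
    destruct (classic (R x a)) as [Rxa|Nxa].
    - exists (p, y). simpl. repeat split; trivial. intro Rya. exact (Nxy (Rtree _ _ _ xy Rxa Rya)).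
    - exists (p, x). simpl. repeat split; trivial. exact (lt_tr WO xy yf). }
  (* For [p < p'], the witness satisfies [d < f p <= p']. From [R d d'], [Rtree] would give
     [R d p'], hence [R d a]. *)
  assert (apart : forall i i', fst (g i) < fst (g i') ->
    snd (g i) < snd (g i') /\ ~ R (snd (g i)) (snd (g i'))).
  { intros i i' h.
    destruct (Hg i) as (_ & _ & _ & _ & _ & df & Nd).
    destruct (Hg i') as ((_ & Ep' & _) & Rpa' & _ & _ & Rpd' & _ & _).
    pose proof (lt_le_tr WO df (Ep' _ h)) as dp'. split.
    - exact (lt_tr WO dp' (Rlt _ _ Rpd')).
    - intro Rdd. apply Nd. exact (Rtr _ _ _ (Rtree _ _ _ dp' Rdd Rpd') Rpa'). }
  assert (fst_inj : forall i i', fst (g i) = fst (g i') -> i = i').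
  { intros i i' h. destruct (Hg i) as (_ & _ & Hi & _), (Hg i') as (_ & _ & Hi' & _).
    rewrite h, Hi' in Hi. destruct i, i'. now apply subset_eq_compat. }
  destruct (noanti (fun i => snd (g i))) as (i & i' & HR).
  - intro i. apply Hg.
  - intros i i' h. apply fst_inj.
    destruct (lt_total WO (fst (g i)) (fst (g i'))) as [l|[l|l]]; trivial;
      apply apart in l; destruct l as [l _]; rewrite h in l; now destruct (lt_irr WO _ l).
  - destruct (lt_total WO (fst (g i)) (fst (g i'))) as [l|[l|l]].
    + now apply (apart i i' l).
    + apply fst_inj in l. subst i'. exact (lt_irr WO _ (Rlt _ _ HR)).
    + exact (lt_irr WO _ (lt_tr WO (Rlt _ _ HR) (proj1 (apart i' i l)))).
Qed.

(** * Reflection and threads for coherent sequences *)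

Section Square.
Context (k : L) (S : L -> Prop) (Cs : L -> (L -> Prop) -> Prop).
Context (HS : stationary S) (Hcoh : coherent L lt Cs) (Hwidth : width_lt L lt Cs k).

Definition avoids (a : L) (D : L -> Prop) (b : L) : Prop :=
  S b /\ a < b /\
  ~ exists C, Cs b C /\ limit_point C a /\ D = (fun x => C x /\ x < a).

Lemma no_reflection (E : L -> Prop) :
  (exists a b, a < b /\ b < k) -> sDSR L lt k S -> club E ->
  ~ forall a D, E a -> is_limit a -> Cs a D -> stationary (avoids a D).
Proof.
  intros (k0 & k1 & k01 & k1k) HsDSR HE Hst.
  (* A row is stored as its width and its sets. It is nonempty with entries inside [E], so that
     reflection at [g] makes [E] unbounded in [g]. *)
  destruct (choice_fun (fun a (jN : L * (L -> L -> Prop)) =>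
    fst jN < k /\ (exists i, i < fst jN) /\
    (forall i, i < fst jN ->
       (forall x, snd jN i x -> S x /\ E x) /\ stationary (snd jN i)) /\
    (E a -> is_limit a -> forall D, Cs a D ->
       exists i, i < fst jN /\ forall x, snd jN i x -> avoids a D x))) as [jN HjN].
  { intro a. destruct (classic (E a /\ is_limit a)) as [[Ea La]|N].
    - destruct (Hcoh a La) as ((C0 & HC0) & _).
      destruct (enumerate_small WO { C | Cs a C } k) as (j & jk & e & He).
      { constructor. now exists C0. }
      { exact (Hwidth a La). }
      exists (j, fun i x => avoids a (proj1_sig (e i)) x /\ E x). simpl.
      split; [|split; [|split]]; trivial.
      + destruct (He (exist _ C0 HC0)) as (i & ij & _). now exists i.
      + intros i ij. split; [now intros x [(Sx & _) Ex]|].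
        apply stationary_inter_club; trivial. apply Hst; trivial. apply proj2_sig.
      + intros _ _ D HD. destruct (He (exist _ D HD)) as (i & ij & Hi).
        exists i. split; trivial. intros x [Hx _]. now rewrite Hi in Hx.
    (* Default row: its width [k1] is below [k], and nonzero since [k0 < k1]. *)
    - exists (k1, fun _ x => S x /\ E x). simpl. split; [|split; [|split]]; trivial.
      + now exists k0.
      + split; [tauto|]. now apply stationary_inter_club.
      + tauto. }
  destruct (HsDSR (fun a => fst (jN a)) (fun a => snd (jN a))) as (g & F & Hg & Fg & SF & HF).
  - intro a. apply HjN.
  - intros a i Hi. destruct (HjN a) as (_ & _ & H & _). destruct (H i Hi) as [H1 H2].
    split; trivial. intros x Hx. now apply H1.
  - pose proof (uncountable_cf_limit g Hg) as Lg.
    assert (Eu : forall b, b < g -> exists x, E x /\ b < x /\ x < g).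
    { intros b bg. destruct (SF _ (club_in_tail WO g b Hg bg)) as (a & Fa & _ & _).
      destruct (HjN a) as (_ & (i & ij) & H & _).
      destruct (HF a Fa i ij) as [_ HR].
      destruct (HR _ (club_in_tail WO g b Hg bg)) as (x & [Mx _] & xg & [bx _]).
      exists x. repeat split; trivial. now apply (H i ij). }
    destruct (Hcoh g Lg) as ((C & HC) & Hclub & Hco).
    destruct (SF _ (club_in_limit_points WO C E g Hg (Hclub C HC) (proj2 HE) Eu))
      as (a & Fa & ag & (Ca & Ea & _)).
    destruct (HjN a) as (_ & _ & _ & H).
    destruct (H Ea (proj1 Ca) _ (Hco C HC a ag Ca)) as (i & ij & Hi).
    destruct (HF a Fa i ij) as [_ HR].
    (* The limit points of [C] from [a] on form a club in [g], so one of them, [b], lies in the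
       reflecting set; [C] cut at [b] is in [Cs b] by coherence. *)
    destruct (HR (fun x => limit_point C x /\ a <= x /\ x < g)) as (b & [Mb _] & bg & (Cb & _)).
    { apply (club_in_limit_points WO C (fun x => a <= x) g Hg (Hclub C HC)).
      - apply club_ge.
      - intros b bg. destruct (proj1 (proj2 (club_in_tail WO g a Hg ag)) b bg)
          as (x & [ax xg] & bx & _).
        destruct (limit_next g x Lg xg) as (y & xy & yg).
        exists y. repeat split; trivial; [left; exact (lt_tr WO ax xy)|exact (le_lt_tr WO bx xy)]. }
    destruct (Hi b Mb) as (_ & ab & N). apply N.
    exists (fun x => C x /\ x < b). repeat split.
    + exact (Hco C HC b bg Cb).
    + apply Ca.
    + apply Ca.
    + revert Ca. apply limit_point_mono; trivial. intros x xa Cx. split; trivial.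
      exact (lt_tr WO xa ab).
    + apply pred_ext. intro x. split; [|tauto]. intros [Cx xa]. repeat split; trivial.
      exact (lt_tr WO xa ab).
Qed.

(** The union [T] agrees with [D a] below each [a] in [B], so closure and threading at [b] are read
    off from a [D a] with [a] above [b]. *)
Lemma thread_of_chain (B : L -> Prop) (D : L -> L -> Prop) :
  unbounded B -> (forall a, B a -> is_limit a /\ Cs a (D a)) ->
  (forall a b, B a -> B b -> a < b -> D a = (fun x => D b x /\ x < a)) ->
  exists T, thread L lt Cs T.
Proof.
  intros BU BD Bext.
  set (T := fun x => exists a, B a /\ D a x).
  assert (Dclub : forall a, B a -> club_in L lt (D a) a).
  { intros a Ba. destruct (BD a Ba) as [La Ca]. now apply (Hcoh a La). }
  assert (TD : forall a x, B a -> x < a -> (T x <-> D a x)).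
  { intros a x Ba xa. split.
    - intros (b & Bb & Dbx). destruct (lt_total WO a b) as [h|[->|h]]; trivial.
      + rewrite (Bext a b Ba Bb h). now split.
      + rewrite (Bext b a Bb Ba h) in Dbx. apply Dbx.
    - intro H. now exists a. }
  exists T. split; [split|].
  - intro b. destruct (unbounded_gt B b BU) as (a & Ba & ba).
    destruct (proj1 (proj2 (Dclub a Ba)) b ba) as (c & Dc & bc & _).
    exists c. split; trivial. now exists a.
  - intros b Tb. destruct (unbounded_gt B b BU) as (a & Ba & ba).
    apply (TD a b Ba ba). apply (Dclub a Ba); trivial. revert Tb.
    apply (limit_point_mono WO). intros x xb. apply TD; trivial. exact (lt_tr WO xb ba).
  - intros b Tb. destruct (unbounded_gt B b BU) as (a & Ba & ba).
    assert (Db : limit_point (D a) b).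
    { revert Tb. apply (limit_point_mono WO). intros x xb. apply TD; trivial.
      exact (lt_tr WO xb ba). }
    destruct (BD a Ba) as [La Ca].
    replace (fun x => T x /\ x < b) with (fun x => D a x /\ x < b).
    + now apply (Hcoh a La).
    + apply pred_ext. intro x. split; intros [H xb]; split; trivial;
        apply (TD a x Ba (lt_tr WO xb ba)); trivial.
Qed.

Lemma thread_of_nonstationary :
  stationary (fun a => is_limit a /\ exists D, Cs a D /\ ~ stationary (avoids a D)) ->
  exists T, thread L lt Cs T.
Proof.
  set (A := fun a => _). intro SA.
  (* For [a] in [A], [fst] is the chosen [D a] and [snd] a club disjoint from [avoids a (D a)];
     elsewhere both are defaults. *)
  destruct (choice_fun (fun a (DB : (L -> Prop) * (L -> Prop)) => club (snd DB) /\
    (A a -> is_limit a /\ Cs a (fst DB) /\ forall x, snd DB x -> ~ avoids a (fst DB) x)))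
    as [DB HDB].
  { intro a. destruct (classic (A a)) as [Aa|N].
    - pose proof Aa as (La & D & HD & Hn). apply not_all_ex_not in Hn. destruct Hn as [B HB].
      apply imply_to_and in HB. destruct HB as [HB HN].
      exists (D, B). simpl. split; trivial. intros _. repeat split; trivial; try apply La.
      intros x Bx Hx. apply HN. now exists x.
    - exists (S, fun x => a <= x). simpl. split; [apply club_ge|tauto]. }
  set (D := fun a => fst (DB a)).
  set (R := fun a b => a < b /\ limit_point (D b) a /\ D a = (fun x => D b x /\ x < a)).
  destruct (stationary_tree_branch k A R SA) as (B & BU & BA & Bchain).
  - now intros x y [h _].
  - intros x y z (xy & lxy & exy) (yz & lyz & eyz). split; [exact (lt_tr WO xy yz)|split].
    + revert lxy. apply (limit_point_mono WO). intros t _. rewrite eyz. tauto.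
    + rewrite exy, eyz. apply pred_ext. intro t. split; [tauto|]. intros [Dt tx].
      repeat split; trivial. exact (lt_tr WO tx xy).
  - intros x y z xy (xz & lxz & exz) (yz & lyz & eyz). split; [trivial|split].
    + revert lxz. apply (limit_point_mono WO). intros t tx Dt. rewrite eyz. split; trivial.
      exact (lt_tr WO tx xy).
    + rewrite exz, eyz. apply pred_ext. intro t. split; [|tauto]. intros [Dt tx].
      repeat split; trivial. exact (lt_tr WO tx xy).
  - intros g Ag ginj.
    destruct (small_family_bounded g) as [c Hc].
    { apply Reg. }
    (* [b] lies in [S], above every [g i] and in each of their clubs, so every [D (g i)] is an
       initial segment of some member of [Cs b]. *)
    destruct (stationary_diagonal S (fun a => snd (DB a)) c HS) as (b & Sb & cb & Lb & Hb).
    { intro a. apply HDB. }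
    destruct (choice_fun (fun i (C : { C | Cs b C }) => limit_point (proj1_sig C) (g i) /\
      D (g i) = (fun x => proj1_sig C x /\ x < g i))) as [h Hh].
    { intro i. pose proof (lt_tr WO (Hc i) cb) as gb.
      destruct (HDB (g i)) as [_ H]. destruct (H (Ag i)) as (_ & _ & Hav).
      specialize (Hav b (Hb _ gb)). apply NNPP; intro N. apply Hav. repeat split; trivial.
      intros (C & HC & HC'). apply N. now exists (exist _ C HC). }
    (* Distinct nodes sent by [h] to the same set are comparable; with no related pair [h] would be
       injective, against the width. *)
    apply NNPP; intro N. apply (Hwidth b Lb). exists h.
    assert (key : forall i i', h i = h i' -> g i < g i' -> R (g i) (g i')).
    { intros i i' E l. destruct (Hh i) as [l1 e1], (Hh i') as [l2 e2].
      rewrite E in l1, e1. split; [trivial|split].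
      - revert l1. apply (limit_point_mono WO). intros t tl Ct. rewrite e2. split; trivial.
        exact (lt_tr WO tl l).
      - rewrite e1, e2. apply pred_ext. intro t. split; [|tauto]. intros [Ct tl].
        repeat split; trivial. exact (lt_tr WO tl l). }
    intros i i' E. apply ginj. destruct (lt_total WO (g i) (g i')) as [l|[l|l]]; trivial.
    + destruct N. exists i, i'. auto.
    + destruct N. exists i', i. auto.
  - apply (thread_of_chain B D BU).
    + intros a Ba. destruct (HDB a) as [_ H]. destruct (H (BA a Ba)) as (La & Ca & _). now split.
    + intros a b Ba Bb ab. now apply Bchain.
Qed.

End Square.
End Regular.

Theorem theorem2p1 (L : Type) (lt : L -> L -> Prop)
  (Hlambda : regular_uncountable L lt)
  (k : L) (Hk : is_cardinal L lt k)
  (Hk1 : exists a b, lt a b /\ lt b k)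
  (S : L -> Prop) (HS : stationary L lt S)
  (HsDSR : sDSR L lt k S) :
  ~ square L lt k.
Proof.
  intros (Cs & Hcoh & Hwidth & Hthread). apply Hthread.
  apply (thread_of_nonstationary Hlambda k S Cs HS Hcoh Hwidth).
  (* A club [E] missing the set in question satisfies the hypothesis refuted by [no_reflection]. *)
  intros E HE. apply NNPP; intro N.
  apply (no_reflection Hlambda k S Cs HS Hcoh Hwidth E Hk1 HsDSR HE).
  intros a D Ea La HD. apply NNPP; intro Nst. apply N.
  exists a. repeat split; trivial; try apply La. now exists D.
Qed.
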